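(* Let $k$ be an algebraically closed field of odd characteristic, and let $G$ and $H$ be finite groups. Let $M$ be an $H\times G$-bimodule inducing a Morita equivalence between a block $B_G$ of $kG$ and a block $B_H$ of $kH$. If $M$ is of symmetric type, then the equivalence preserves the type of simple self-dual modules: for every simple self-dual left $B_G$-module $V$, the simple left $B_H$-module $M\otimes_{kG}V$ is self-dual and has the same type (symmetric or antisymmetric) as $V$.
   Context: An $H\times G$-bimodule is a $k$-vector space with a left $kH$-action and a commuting right $kG$-action. A $k$-bilinear form $(\cdot,\cdot)$ on an $H\times G$-bimodule $M$ is $H\times G$-invariant if $(hmg,hng)=(m,n)$ for all $h\in H$, $g\in G$, $m,n\in M$. $M$ is of symmetric type if it carries a non-degenerate $H\times G$-invariant symmetric $k$-bilinear form. For a finite group $\Gamma$, a left $k\Gamma$-module $T$ is self-dual if $T\cong T^*$, where $T^*=\mathrm{Hom}_k(T,k)$ with $(gf)(t)=f(g^{-1}t)$. If $T$ is simple and self-dual and $k$ is algebraically closed of odd characteristic, $T$ carries a non-degenerate $\Gamma$-invariant $k$-bilinear form, unique up to a scalar, and this form is either symmetric or antisymmetric; this is called the type of $T$. A block of $kG$ is an indecomposable two-sided direct factor of the algebra $kG$. An $H\times G$-bimodule $M$ induces a Morita equivalence between $B_G$ and $B_H$ if $M$ is a progenerator as a left $B_H$-module and as a right $B_G$-module and the functor $V\mapsto M\otimes_{kG}V$ is an equivalence from the category of left $B_G$-modules onto the category of left $B_H$-modules. *)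

(* Defs.v *)
From HB Require Import structures.
From mathcomp Require Import all_boot all_order all_fingroup all_algebra.
From mathcomp Require Import boolp.
From mathcomp Require Import freeg.

Set Implicit Arguments.
Unset Strict Implicit.
Unset Printing Implicit Defensive.

Import GRing.Theory generic_quotient.
Local Open Scope ring_scope.
Local Open Scope quotient_scope.

(* The group algebra kG: functions G -> k under convolution.  Left kG-modules *)
(* are lmodType (galg k G), and g in G acts on them as gbase g *: _.          *)
Definition galg (k : fieldType) (G : finGroupType) : Type := {ffun G -> k^o}.

Section GroupAlgebra.
Variables (k : fieldType) (G : finGroupType).
Local Notation kG := (galg k G).

HB.instance Definition _ := GRing.Lmodule.copy kG {ffun G -> k^o}.

Definition gbase (g : G) : kG := [ffun x => (x == g)%:R].

Definition gmul (a b : kG) : kG := [ffun x => \sum_y a y * b (y^-1 * x)%g].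

Fact gmulA : associative gmul.
Proof.
move=> a b c; apply/ffunP=> x; rewrite !ffunE.
under eq_bigr => y _ do rewrite ffunE mulr_sumr.
under [RHS]eq_bigr => y _ do rewrite ffunE mulr_suml.
rewrite [RHS]exchange_big /=; apply: eq_bigr => y _.
rewrite [RHS](reindex (fun z => y * z)%g) /=; last first.
  by exists (fun z => y^-1 * z)%g => z _; rewrite ?mulKg ?mulKVg.
by apply: eq_bigr => z _; rewrite mulKg invMg -!mulgA mulrA.
Qed.

Fact gmul1l : left_id (gbase 1%g) gmul.
Proof.
move=> a; apply/ffunP=> x; rewrite ffunE (bigD1 1%g) //= ffunE eqxx mul1r.
rewrite invg1 mul1g big1 ?addr0 // => y /negPf ny.
by rewrite ffunE ny mul0r.
Qed.

Fact gmul1r : right_id (gbase 1%g) gmul.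
Proof.
move=> a; apply/ffunP=> x; rewrite ffunE (bigD1 x) //= ffunE mulVg eqxx mulr1.
rewrite big1 ?addr0 // => y /negPf nyx; rewrite ffunE.
by rewrite -eq_mulVg1 nyx mulr0.
Qed.

Fact gmulDl : left_distributive gmul +%R.
Proof.
move=> a b c; apply/ffunP=> x; rewrite !ffunE -big_split.
by apply: eq_bigr => y _; rewrite ffunE mulrDl.
Qed.

Fact gmulDr : right_distributive gmul +%R.
Proof.
move=> a b c; apply/ffunP=> x; rewrite !ffunE -big_split.
by apply: eq_bigr => y _; rewrite ffunE mulrDr.
Qed.

Fact gbase1_neq0 : gbase 1%g != 0.
Proof.
by apply/eqP=> /ffunP/(_ 1%g); rewrite !ffunE eqxx => /eqP; rewrite oner_eq0.
Qed.

HB.instance Definition _ := GRing.Zmodule_isNzRing.Build kG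
  gmulA gmul1l gmul1r gmulDl gmulDr gbase1_neq0.

Fact gscaleAl (c : k) (a b : kG) : c *: (a * b) = (c *: a) * b.
Proof.
apply/ffunP=> x; rewrite !ffunE scaler_sumr.
by apply: eq_bigr => y _; rewrite ffunE -[RHS]mulrA.
Qed.

Fact gscaleAr (c : k) (a b : kG) : c *: (a * b) = a * (c *: b).
Proof.
apply/ffunP=> x; rewrite !ffunE scaler_sumr.
by apply: eq_bigr => y _; rewrite ffunE [RHS]mulrCA.
Qed.

HB.instance Definition _ := GRing.Lmodule_isLalgebra.Build k kG gscaleAl.
HB.instance Definition _ := GRing.Lalgebra_isAlgebra.Build k kG gscaleAr.

Lemma gbaseM (g h : G) : gbase (g * h)%g = gbase g * gbase h.
Proof.
apply/ffunP=> x; rewrite !ffunE (bigD1 g) //= !ffunE eqxx mul1r.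
rewrite big1 ?addr0 => [|y /negPf ny]; last by rewrite ffunE ny mul0r.
by rewrite -[in RHS](inj_eq (mulgI g)) mulKVg.
Qed.

Lemma gbase1 : gbase 1%g = 1. Proof. by []. Qed.

Lemma galg_sum_base (a : kG) : a = \sum_g (a g : k) *: gbase g.
Proof.
apply/ffunP=> x; rewrite sum_ffunE (bigD1 x) //= !ffunE eqxx.
rewrite big1 => [|y /negPf ny]; last by rewrite !ffunE eq_sym ny scaler0.
by rewrite addr0 [RHS]mulr1.
Qed.

End GroupAlgebra.

Arguments gbase {k G} g.

Section Blocks.
Variable A : nzRingType.
Implicit Types I J B : {pred A}.

Definition two_sided_ideal I :=
  zmod_closed I /\
  forall a x, x \in I -> (a * x \in I) /\ (x * a \in I).

Definition ideal_dsum I J B :=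
  [/\ forall x, x \in I -> x \in J -> x = 0,
      forall x y, x \in I -> y \in J -> x + y \in B
    & forall z, z \in B -> exists x y, [/\ x \in I, y \in J & z = x + y]].

Definition direct_factor B :=
  two_sided_ideal B /\
  exists2 B' : {pred A}, two_sided_ideal B' & ideal_dsum B B' predT.

Definition indecomposable_ideal B :=
  (exists2 x, x \in B & x != 0) /\
  forall I J, two_sided_ideal I -> two_sided_ideal J -> ideal_dsum I J B ->
    (forall x, x \in I -> x = 0) \/ (forall x, x \in J -> x = 0).

Definition is_block B := direct_factor B /\ indecomposable_ideal B.

Definition identity_of B e :=
  e \in B /\ forall x, x \in B -> e * x = x /\ x * e = x.

(* A left module over the algebra B (whose identity element e is in general   *)
(* not 1) is encoded as a left A-module on which e acts as the identity.      *)
Definition belongs_to B (V : lmodType A) :=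
  exists2 e, identity_of B e & forall v : V, e *: v = v.

End Blocks.

Record bmodule (A : nzRingType) (B : {pred A}) := BModule {
  bmod_sort :> lmodType A;
  bmodP : belongs_to B bmod_sort
}.

Section Modules.
Variables (A : nzRingType) (B : {pred A}).

Definition simple_module (V : lmodType A) :=
  (exists v : V, v != 0) /\
  forall S : {pred V}, submod_closed S ->
    (forall v, v \in S -> v = 0) \/ (forall v, v \in S).

Definition fin_generated (P : lmodType A) :=
  exists (n : nat) (s : 'I_n -> P),
    forall x, exists c : 'I_n -> A, x = \sum_i c i *: s i.

Definition projective (P : lmodType A) :=
  forall (U W : bmodule B) (q : {linear U -> W}) (f : {linear P -> W}),
    (forall w, exists u, q u = w) -> exists f' : {linear P -> U}, q \o f' =1 f.

Definition generator (P : lmodType A) :=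
  forall (U W : bmodule B) (f g : {linear U -> W}),
    (forall h : {linear P -> U}, f \o h =1 g \o h) -> f =1 g.

Definition progenerator (P : lmodType A) :=
  [/\ belongs_to B P, fin_generated P, projective P & generator P].

End Modules.

(* Functors between the categories of all left modules over B and over B'.    *)
Record mod_functor (A A' : nzRingType) (B : {pred A}) (B' : {pred A'}) :=
  ModFunctor {
    fobj :> bmodule B -> bmodule B';
    fmap : forall U V : bmodule B, {linear U -> V} -> {linear fobj U -> fobj V};
    fmap_id : forall U : bmodule B, fmap (idfun : {linear U -> U}) =1 idfun;
    fmap_comp : forall (U V W : bmodule B)
      (g : {linear V -> W}) (f : {linear U -> V}),
      fmap (g \o f : {linear U -> W}) =1 fmap g \o fmap f
  }.

Section Equivalence.
Variables (A A' : nzRingType) (B : {pred A}) (B' : {pred A'}).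

Definition is_equivalence (F : mod_functor B B') :=
  exists K : mod_functor B' B,
    (exists eta : forall V : bmodule B, {linear V -> K (F V)},
       (forall V, bijective (eta V)) /\
       forall (U V : bmodule B) (f : {linear U -> V}),
         eta V \o f =1 fmap K (fmap F f) \o eta U) /\
    (exists eps : forall W : bmodule B', {linear F (K W) -> W},
       (forall W, bijective (eps W)) /\
       forall (U W : bmodule B') (f : {linear U -> W}),
         eps W \o fmap F (fmap K f) =1 f \o eps U).

End Equivalence.

(* The tensor product over an arbitrary ring A of a right module M, i.e. a    *)
(* left module over the converse ring with x * a := a *: x, and of a left     *)
(* module V: the free abelian group on M * V modulo the usual relations.      *)
Section Tensor.
Variables (A : nzRingType) (M : lmodType A^c) (V : lmodType A).

Local Notation free := {freeg (M * V)%type / int}.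

Definition tens_rel (x : free) : Prop :=
  [\/ exists m m' v, x = << (m + m', v) >> - << (m, v) >> - << (m', v) >>,
      exists m v v', x = << (m, v + v') >> - << (m, v) >> - << (m, v') >>
    | exists (m : M) (a : A) (v : V),
        x = << ((a : A^c) *: m, v) >> - << (m, a *: v) >>].

Definition tens_null : {pred free} := fun x =>
  `[< forall S : {pred free}, zmod_closed S ->
      (forall y, tens_rel y -> y \in S) -> x \in S >].

Fact tens_null_zmod : zmod_closed tens_null.
Proof.
split=> [|x y /asboolP hx /asboolP hy]; apply/asboolP => S hS hrel.
  by case: hS.
by case: (hS) => _; apply; [apply: hx | apply: hy].
Qed.

HB.instance Definition _ := GRing.isZmodClosed.Build free tens_null
  tens_null_zmod.

Definition tens : Type := {ideal_quot tens_null}.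

HB.instance Definition _ := GRing.Zmodule.on tens.

Definition pi_tens (x : free) : tens := \pi_{ideal_quot tens_null} x.

Definition tmul (m : M) (v : V) : tens := pi_tens << (m, v) >>.

Lemma pi_tensB : {morph pi_tens : x y / x - y}.
Proof. exact: (raddfB (\pi_{ideal_quot tens_null})). Qed.

Lemma pi_tens0 : pi_tens 0 = 0.
Proof. by have := pi_tensB 0 0; rewrite !subrr. Qed.

Lemma pi_tens_eq0 x : (pi_tens x == 0) = (x \in tens_null).
Proof. by rewrite -pi_tens0 /pi_tens -Quotient.idealrBE subr0. Qed.

Lemma tens_rel_eq0 x : tens_rel x -> pi_tens x = 0.
Proof.
by move=> hx; apply/eqP; rewrite pi_tens_eq0; apply/asboolP => S _; apply.
Qed.

Lemma tmulDl v : {morph tmul^~ v : m m' / m + m'}.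
Proof.
move=> m m'; apply/eqP; rewrite -subr_eq0 opprD addrA /tmul -!pi_tensB.
by apply/eqP/tens_rel_eq0/Or31; exists m, m', v.
Qed.

Lemma tmulDr m : {morph tmul m : v v' / v + v'}.
Proof.
move=> v v'; apply/eqP; rewrite -subr_eq0 opprD addrA /tmul -!pi_tensB.
by apply/eqP/tens_rel_eq0/Or32; exists m, v, v'.
Qed.

Lemma tmulA (m : M) (a : A) (v : V) :
  tmul ((a : A^c) *: m) v = tmul m (a *: v).
Proof.
apply/eqP; rewrite -subr_eq0 /tmul -pi_tensB.
by apply/eqP/tens_rel_eq0/Or33; exists m, a, v.
Qed.

Lemma tens_ind (P : tens -> Prop) :
  P 0 -> (forall x y, P x -> P y -> P (x - y)) -> (forall m v, P (tmul m v)) ->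
  forall x, P x.
Proof.
move=> P0 PB Pt x.
have PD y z : P y -> P z -> P (y + z).
  by move=> Py Pz; rewrite -[z]opprK -[- z]add0r; apply/PB/PB.
have PMn y n : P y -> P (y *+ n).
  by move=> Py; elim: n => [|n IHn]; rewrite ?mulr0n // mulrS; apply: PD.
have piD : {morph pi_tens : y z / y + z}.
  exact: (raddfD (\pi_{ideal_quot tens_null})).
rewrite -[x]reprK -[repr x]freeg_sumE.
rewrite -[\pi _]/(pi_tens _) (big_morph _ piD pi_tens0).
apply: (big_ind P) => // -[m v] _.
have piMz z : pi_tens << z *g (m, v) >> = tmul m v *~ z.
  rewrite /tmul -(raddfMz (\pi_{ideal_quot tens_null})) freegU_mulz.
  by rewrite intz.
rewrite piMz; case: (coeff _ _) => n; first exact: PMn.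
by rewrite NegzE mulrNz -[- _]add0r; apply/PB/PMn.
Qed.

Record balanced (W : zmodType) (phi : M -> V -> W) : Prop := Balanced {
  balancedDl : forall v, {morph phi^~ v : m m' / m + m'};
  balancedDr : forall m, {morph phi m : v v' / v + v'};
  balancedA : forall m (a : A) v, phi ((a : A^c) *: m) v = phi m (a *: v)
}.

Definition tens_lift (W : zmodType) (phi : M -> V -> W) (x : tens) : W :=
  fglift (fun mv => phi mv.1 mv.2 : zmodule W)
    (repr (x : {ideal_quot tens_null})).

Section Lift.
Variables (W : zmodType) (phi : M -> V -> W) (hphi : balanced phi).

Lemma tens_lift_pi (x : free) :
  tens_lift phi (pi_tens x) = fglift (fun mv => phi mv.1 mv.2 : zmodule W) x.
Proof.
rewrite /tens_lift; set f := fglift _.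
have fB y z : f (y - z) = f y - f z by exact: (lift_is_additive _ y z).
have f0 : f 0 = 0 by have := fB 0 0; rewrite !subrr.
have f1 mv : f << mv >> = phi mv.1 mv.2 by rewrite /f liftU scale1r.
have fnull y : y \in tens_null -> f y = 0.
  move=> /asboolP /(_ (fun y => `[< f y = 0 >])) hy; apply/asboolP/hy.
    split=> [|u v /asboolP fu /asboolP fv]; apply/asboolP => //.
    by rewrite fB fu fv subrr.
  move=> _ [[m [m' [v ->]]]|[m [v [v' ->]]]|[m [a [v ->]]]]; apply/asboolP.
  - by rewrite !fB !f1 /= (balancedDl hphi) addrAC addrK subrr.
  - by rewrite !fB !f1 /= (balancedDr hphi) addrAC addrK subrr.
  by rewrite fB !f1 /= (balancedA hphi) subrr.
apply/eqP; rewrite -subr_eq0 -fB fnull //.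
by rewrite Quotient.idealrBE reprK.
Qed.

Lemma tens_liftE m v : tens_lift phi (tmul m v) = phi m v.
Proof. by rewrite tens_lift_pi liftU scale1r. Qed.

Lemma tens_liftB : {morph tens_lift phi : x y / x - y}.
Proof.
move=> x y; rewrite -[x]reprK -[y]reprK.
rewrite -![\pi _]/(pi_tens _) -pi_tensB !tens_lift_pi.
set f := fglift _; rewrite -[RHS]/(f _ - f _).
exact: (lift_is_additive (_ : _ -> zmodule W)).
Qed.

End Lift.

End Tensor.

Section TensorMap.
Variables (A : nzRingType) (M N : lmodType A^c) (V W : lmodType A).
Variables (f : {linear M -> N}) (g : {linear V -> W}).

Definition tens_map : tens M V -> tens N W :=
  tens_lift (fun m v => tmul (f m) (g v)).

Fact tens_map_balanced : balanced (fun m v => tmul (f m) (g v)).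
Proof.
split=> [v m m'|m v v'|m a v]; first by rewrite raddfD tmulDl.
  by rewrite raddfD tmulDr.
by rewrite !linearZ /= tmulA.
Qed.

Lemma tens_mapE m v : tens_map (tmul m v) = tmul (f m) (g v).
Proof. exact: tens_liftE tens_map_balanced _ _. Qed.

Fact tens_map_zmod_morphism : zmod_morphism tens_map.
Proof. exact: tens_liftB tens_map_balanced. Qed.

HB.instance Definition _ :=
  GRing.isZmodMorphism.Build (tens M V) (tens N W) tens_map
    tens_map_zmod_morphism.

End TensorMap.

Lemma tens_ext (A : nzRingType) (M : lmodType A^c) (V : lmodType A)
    (W : zmodType) (f g : {additive tens M V -> W}) :
  (forall m v, f (tmul m v) = g (tmul m v)) -> f =1 g.
Proof.
move=> fg; apply: tens_ind => [|x y fx fy|m v]; last exact: fg.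
  by rewrite !raddf0.
by rewrite !raddfB fx fy.
Qed.

(* A k-vector space with commuting left A- and right B-actions, both          *)
(* compatible with its k-structure.                                           *)
HB.mixin Record Lmodule_isBimodule (k : fieldType) (A B : algType k) M
    of GRing.Lmodule k M := {
  lact : A -> M -> M;
  lactDl : forall m, {morph lact^~ m : a b / a + b};
  lactDr : forall a, {morph lact a : m n / m + n};
  lactZl : forall (c : k) a m, lact (c *: a) m = c *: lact a m;
  lactZr : forall (c : k) a m, lact a (c *: m) = c *: lact a m;
  lact1 : forall m, lact 1 m = m;
  lactA : forall a b m, lact a (lact b m) = lact (a * b) m;
  ract : M -> B -> M;
  ractDl : forall b, {morph ract^~ b : m n / m + n};
  ractDr : forall m, {morph ract m : a b / a + b};
  ractZl : forall (c : k) m b, ract (c *: m) b = c *: ract m b;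
  ractZr : forall (c : k) m b, ract m (c *: b) = c *: ract m b;
  ract1 : forall m, ract m 1 = m;
  ractA : forall m a b, ract (ract m a) b = ract m (a * b);
  lractA : forall a m b, ract (lact a m) b = lact a (ract m b)
}.

#[short(type="bimodType")]
HB.structure Definition Bimodule (k : fieldType) (A B : algType k) :=
  { M of GRing.Lmodule k M & Lmodule_isBimodule k A B M }.

(* Right B-modules are left modules over the converse ring B^c.               *)
Definition left_of (k : fieldType) (A B : algType k) (M : bimodType A B) : Type
  := M.
Definition right_of (k : fieldType) (A B : algType k) (M : bimodType A B) : Type
  := M.

Section OneSided.
Variables (k : fieldType) (A B : algType k) (M : bimodType A B).

HB.instance Definition _ := GRing.Zmodule.on (left_of M).

HB.instance Definition _ := GRing.Zmodule_isLmodule.Build A (left_of M)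
  (fun a b m => lactA a b m) (fun m => lact1 m) (fun a m n => lactDr a m n)
  (fun m a b => lactDl m a b).

HB.instance Definition _ := GRing.Zmodule.on (right_of M).

Fact right_scaleA (a b : B^c) (m : M) :
  ract (ract m b) a = ract m (a * b : B^c).
Proof. exact: ractA. Qed.

HB.instance Definition _ := GRing.Zmodule_isLmodule.Build B^c (right_of M)
  right_scaleA (fun m => ract1 m) (fun b m n => ractDl b m n)
  (fun m a b => ractDr m a b).

Definition lmulr (a : A) (m : right_of M) : right_of M := lact a (m : M).

Fact lmulr_linear a : linear (lmulr a).
Proof. by move=> b m n; rewrite /lmulr lactDr -lractA. Qed.

HB.instance Definition _ a := GRing.isLinear.Build B^c (right_of M) (right_of M)
  *:%R (lmulr a) (lmulr_linear a).

Variable V : lmodType B.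

(* The tensor product of M and V over B, with A acting through M.             *)
Definition tensor : Type := tens (right_of M) V.

HB.instance Definition _ := GRing.Zmodule.on tensor.

Definition tensor_scale (a : A) (x : tensor) : tensor :=
  tens_map (lmulr a) (idfun : {linear V -> V}) x.

Fact tensor_scaleA a b x :
  tensor_scale a (tensor_scale b x) = tensor_scale (a * b) x.
Proof.
move: x; apply: (@tens_ext _ _ _ _
  (tens_map (lmulr a) (idfun : {linear V -> V}) \o
   tens_map (lmulr b) (idfun : {linear V -> V}))) => m v /=.
by rewrite /tensor_scale !tens_mapE /= /lmulr lactA.
Qed.

Fact tensor_scale1 : left_id 1 tensor_scale.
Proof.
apply: (@tens_ext _ _ _ _
  (tens_map (lmulr 1) (idfun : {linear V -> V})) idfun).
by move=> m v /=; rewrite tens_mapE /= /lmulr lact1.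
Qed.

Fact tensor_scaleDr : right_distributive tensor_scale +%R.
Proof. by move=> a x y; rewrite /tensor_scale raddfD. Qed.

Fact tensor_scaleDl x : {morph tensor_scale^~ x : a b / a + b}.
Proof.
move=> a b; move: x; apply: (@tens_ext _ _ _ _ _
  (tens_map (lmulr a) (idfun : {linear V -> V}) \+
   tens_map (lmulr b) (idfun : {linear V -> V}))) => m v /=.
by rewrite /tensor_scale !tens_mapE /= /lmulr lactDl tmulDl.
Qed.

HB.instance Definition _ := GRing.Zmodule_isLmodule.Build A tensor
  tensor_scaleA tensor_scale1 tensor_scaleDr tensor_scaleDl.

Lemma tensor_scaleE (a : A) (m : M) (v : V) :
  a *: (tmul (m : right_of M) v : tensor) = tmul (lact a m : right_of M) v.
Proof. exact: tens_mapE. Qed.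

End OneSided.

Section TensorFunctor.
Variables (k : fieldType) (A B : algType k) (M : bimodType A B).

Definition tensor_map (V W : lmodType B) (f : {linear V -> W}) :
    tensor M V -> tensor M W :=
  tens_map (idfun : {linear right_of M -> right_of M}) f.

Fact tensor_map_linear V W f : linear (@tensor_map V W f).
Proof.
move=> a x y; rewrite {1}/tensor_map raddfD; congr (_ + _).
move: x; apply: (@tens_ext _ _ _ _
  (tens_map _ _ \o tens_map _ _) (tens_map _ _ \o tens_map _ _)) => m v /=.
by rewrite !tens_mapE.
Qed.

HB.instance Definition _ V W f :=
  GRing.isLinear.Build A (tensor M V) (tensor M W) *:%R
    (@tensor_map V W f) (@tensor_map_linear V W f).

Variables (JA : {pred A}) (JB : {pred B}).
Hypothesis hM : belongs_to JA (left_of M).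

Fact tensor_belongs_to (V : lmodType B) : belongs_to JA (tensor M V).
Proof.
have [e he eM] := hM; exists e => //.
apply: (@tens_ext _ _ _ _ (tens_map _ _) idfun) => m v /=.
by rewrite tens_mapE /= /lmulr [lact e _](eM m).
Qed.

Fact tensor_map_id (V : bmodule JB) :
  tensor_map (idfun : {linear V -> V}) =1 idfun.
Proof.
by apply: (@tens_ext _ _ _ _ (tens_map _ _) idfun) => m v /=; rewrite tens_mapE.
Qed.

Fact tensor_map_comp (U V W : bmodule JB) (g : {linear V -> W})
    (f : {linear U -> V}) :
  tensor_map (g \o f : {linear U -> W}) =1 tensor_map g \o tensor_map f.
Proof.
apply: (@tens_ext _ _ _ _ (tens_map _ _)
  (tens_map _ _ \o tens_map _ _)) => m v /=.
by rewrite !tens_mapE.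
Qed.

Definition tensor_functor : mod_functor JB JA :=
  @ModFunctor _ _ JB JA (fun V => BModule (tensor_belongs_to V))
    (fun V W f => @tensor_map V W f) tensor_map_id tensor_map_comp.

End TensorFunctor.

Definition induces_morita (k : fieldType) (A B : algType k)
    (JA : {pred A}) (JB : {pred B}) (M : bimodType A B) :=
  [/\ progenerator JA (left_of M), progenerator (JB : {pred B^c}) (right_of M)
    & exists hM : belongs_to JA (left_of M),
        is_equivalence (@tensor_functor k A B M JA JB hM)].

(* Restriction of scalars along c |-> c%:A.                                   *)
Definition kspace (k : fieldType) (A : algType k) (V : lmodType A) : Type := V.

Section Restriction.
Variables (k : fieldType) (A : algType k) (V : lmodType A).

HB.instance Definition _ := GRing.Zmodule.on (kspace V).

Definition kscale (c : k) (v : kspace V) : kspace V := c%:A *: (v : V).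

Fact kscaleA c d v : kscale c (kscale d v) = kscale (c * d) v.
Proof. by rewrite /kscale scalerA -scalerAl mul1r scalerA. Qed.
Fact kscale1 : left_id 1 kscale.
Proof. by move=> v; rewrite /kscale !scale1r. Qed.
Fact kscaleDr : right_distributive kscale +%R.
Proof. by move=> c u v; rewrite /kscale scalerDr. Qed.
Fact kscaleDl v : {morph kscale^~ v : c d / c + d}.
Proof. by move=> c d; rewrite /kscale !scalerDl. Qed.

HB.instance Definition _ := GRing.Zmodule_isLmodule.Build k (kspace V)
  kscaleA kscale1 kscaleDr kscaleDl.

End Restriction.

(* Hom_k(V, k); by dual_scaleE below, (g f)(t) = f (g^-1 t).                  *)
Definition dual (k : fieldType) (G : finGroupType) (V : lmodType (galg k G)) :
  Type := {scalar kspace V}.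

Section Dual.
Variables (k : fieldType) (G : finGroupType) (V : lmodType (galg k G)).
Local Notation dV := (dual V).
Local Notation sV := {scalar kspace V}.

HB.instance Definition _ := gen_eqMixin dV.
HB.instance Definition _ := gen_choiceMixin dV.

Definition dual_fun (f : dV) : V -> k := (f : sV).

Lemma dual_ext (f g : dV) : dual_fun f =1 dual_fun g -> f = g.
Proof.
case: f g => [f [[af] [sf]]] [g [[ag] [sg]]] /funext.
rewrite /dual_fun /= => fg.
by subst g; rewrite (Prop_irrelevance af ag) (Prop_irrelevance sf sg).
Qed.

Definition dual_zero : dV := (\0 : sV).
Definition dual_opp (f : dV) : dV := (\- (f : sV) : sV).
Definition dual_add (f g : dV) : dV := ((f : sV) \+ (g : sV) : sV).

Fact dual_addA : associative dual_add.
Proof. by move=> f g h; apply: dual_ext => t; apply: addrA. Qed.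
Fact dual_addC : commutative dual_add.
Proof. by move=> f g; apply: dual_ext => t; apply: addrC. Qed.
Fact dual_add0 : left_id dual_zero dual_add.
Proof. by move=> f; apply: dual_ext => t; apply: add0r. Qed.
Fact dual_addN : left_inverse dual_zero dual_opp dual_add.
Proof. by move=> f; apply: dual_ext => t; apply: addNr. Qed.

HB.instance Definition _ := GRing.isZmodule.Build dV
  dual_addA dual_addC dual_add0 dual_addN.

Lemma dual_funD (f g : dV) t : dual_fun (f + g) t = dual_fun f t + dual_fun g t.
Proof. by []. Qed.

Definition dual_act (a : galg k G) (f : dV) (t : kspace V) : k :=
  \sum_g (a g : k) * dual_fun f (gbase g^-1 *: (t : V)).

Fact dual_act_scalar a f : scalar (dual_act a f).
Proof.
move=> c s t; rewrite /dual_act mulr_sumr -big_split /=; apply: eq_bigr => g _.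
rewrite mulrCA -mulrDr; congr (_ * _).
rewrite -[RHS](linearP (f : sV) c (gbase g^-1 *: (s : V))
                                  (gbase g^-1 *: (t : V))).
rewrite /dual_fun; congr ((f : sV) _); rewrite scalerDr; congr (_ + _).
have cg : gbase g^-1 * c%:A = c%:A * gbase g^-1 :> galg k G.
  by rewrite -scalerAl -scalerAr mul1r mulr1.
rewrite -[c *: s in LHS]/(c%:A *: (s : V)).
by rewrite scalerA cg -scalerA.
Qed.

HB.instance Definition _ a f :=
  GRing.isLinear.Build k (kspace V) k *%R (dual_act a f) (dual_act_scalar a f).

Definition dual_scale (a : galg k G) (f : dV) : dV := (dual_act a f : sV).

Fact dual_scaleA a b f : dual_scale a (dual_scale b f) = dual_scale (a * b) f.
Proof.
apply: dual_ext => t; rewrite /dual_fun /= /dual_act /dual_fun /= /dual_act.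
under eq_bigr => g _ do rewrite mulr_sumr.
under [RHS]eq_bigr => g _ do rewrite ffunE mulr_suml.
rewrite [RHS]exchange_big /=; apply: eq_bigr => g _.
rewrite [RHS](reindex (fun h => g * h)%g) /=; last first.
  by exists (fun h => g^-1 * h)%g => h _; rewrite ?mulKg ?mulKVg.
by apply: eq_bigr => h _; rewrite mulKg scalerA -gbaseM invMg mulrA.
Qed.

Fact dual_scale1 : left_id 1 dual_scale.
Proof.
move=> f; apply: dual_ext => t; rewrite /dual_fun /= /dual_act (bigD1 1%g) //=.
rewrite ffunE eqxx mul1r invg1 gbase1 scale1r big1 ?addr0 // => g /negPf ng.
by rewrite ffunE ng mul0r.
Qed.

Fact dual_scaleDr : right_distributive dual_scale +%R.
Proof.
move=> a f g; apply: dual_ext => t.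
rewrite dual_funD /dual_fun /= /dual_act -big_split.
by apply: eq_bigr => h _; rewrite dual_funD mulrDr.
Qed.

Fact dual_scaleDl f : {morph dual_scale^~ f : a b / a + b}.
Proof.
move=> a b; apply: dual_ext => t.
rewrite dual_funD /dual_fun /= /dual_act -big_split.
by apply: eq_bigr => h _; rewrite ffunE mulrDl.
Qed.

HB.instance Definition _ := GRing.Zmodule_isLmodule.Build (galg k G) dV
  dual_scaleA dual_scale1 dual_scaleDr dual_scaleDl.

Lemma dual_scaleE (g : G) (f : dV) (t : V) :
  dual_fun (gbase g *: f) t = dual_fun f (gbase g^-1 *: t).
Proof.
rewrite [LHS]/dual_fun /= /dual_act (bigD1 g) //= ffunE eqxx mul1r.
by rewrite big1 ?addr0 // => h /negPf nh; rewrite ffunE nh mul0r.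
Qed.

Definition self_dual := exists phi : {linear V -> dV}, bijective phi.

End Dual.

Definition nondegenerate_form (k : fieldType) (U : lmodType k)
    (b : {biscalar U}) :=
  (forall x, (forall y, b x y = 0) -> x = 0) /\
  (forall y, (forall x, b x y = 0) -> y = 0).

Inductive form_type := Symmetric | Antisymmetric.

Definition form_has_type (k : fieldType) (U : lmodType k) (e : form_type)
    (b : {biscalar U}) :=
  match e with
  | Symmetric => forall x y, b x y = b y x
  | Antisymmetric => forall x y, b x y = - b y x
  end.

(* For V simple and self-dual over an algebraically closed field of odd       *)
(* characteristic, V has exactly one type.                                    *)
Definition has_type (k : fieldType) (G : finGroupType)
    (V : lmodType (galg k G)) (e : form_type) :=
  exists b : {biscalar kspace V},
    [/\ nondegenerate_form b,
        forall (g : G) (x y : V), b (gbase g *: x) (gbase g *: y) = b x y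
      & form_has_type e b].

Definition symmetric_bimodule (k : fieldType) (H G : finGroupType)
    (M : bimodType (galg k H) (galg k G)) :=
  exists b : {biscalar M},
    [/\ nondegenerate_form b,
        forall (h : H) (g : G) (m n : M),
          b (ract (lact (gbase h) m) (gbase g))
            (ract (lact (gbase h) n) (gbase g)) = b m n
      & form_has_type Symmetric b].

(* Main.v *)
From HB Require Import structures.
From mathcomp Require Import all_boot all_order all_fingroup all_algebra.
From mathcomp Require Import boolp.
Require Import Defs.

Set Implicit Arguments.
Unset Strict Implicit.
Unset Printing Implicit Defensive.

Import GRing.Theory.
Local Open Scope ring_scope.

(* A nondegenerate G-invariant form b on V and the given form (.,.) on M      *)
(* combine into the H-invariant form                                          *)
(*   <m (x) v, n (x) w> = \sum_g b(g^-1 v, w) (m g, n)                        *)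
(* on M (x)_kG V.  It inherits the sign of b because (.,.) is symmetric, and  *)
(* it is nonzero: otherwise the elements \sum_g b(g^-1 v, w) g of B_G         *)
(* annihilate M, whereas M is faithful over B_G.  On a simple module a        *)
(* nonzero invariant form is nondegenerate and unique up to a scalar, so both *)
(* modules have exactly one type, and the two types agree.                    *)

(** Write c(v, w) = \sum_g b(g^-1 v, w) g ([matrix_coef]) and S for the antipode of kG, so that the
    form on M ⊗ V is built from the scalars (m c(v, w), n). Because c(a v, w) = a c(v, w) and c(v, a
    w) = c(v, w) S(a), these scalars respect the tensor relations in both arguments
    ([tensor_form_exists]). Because S(c(v, w)) = ± c(w, v) with the sign of b, the form has the type
    of b.

    The form is nonzero because c(v, w) is fixed by the identity of B_G and no nonzero such element
    annihilates M: an equivalence is faithful, in particular on right multiplications of B_G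
    ([morita_right_faithful]). Also M ⊗ V is simple ([morita_tensor_simple]).

    On a simple module the radical of an invariant form is a submodule, so a nonzero form gives
    self-duality ([simple_form_self_dual]). Over an algebraically closed field Schur's argument
    makes invariant forms proportional ([simple_forms_proportional]), hence a type exists, and it is
    unique since 2 is nonzero. So it suffices to carry types from V to M ⊗ V; uniqueness gives the
    converse. *)

Section Submodule.
Variables (A : nzRingType) (V : lmodType A) (S : {pred V}).

Definition submod_type of submod_closed S : Type := {x : V | x \in S}.

Variable hS : submod_closed S.

#[local] HB.instance Definition _ := GRing.isSubmodClosed.Build A V S hS.
HB.instance Definition _ := [isSub of submod_type hS for sval].
HB.instance Definition _ := [Choice of submod_type hS by <:].
HB.instance Definition _ := [SubChoice_isSubLmodule of submod_type hS by <:].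

Definition submod_incl (x : submod_type hS) : V := val x.

Fact submod_incl_linear : linear submod_incl.
Proof. by []. Qed.

HB.instance Definition _ :=
  GRing.isLinear.Build A (submod_type hS) V *:%R submod_incl submod_incl_linear.

Lemma submod_belongs_to (B : {pred A}) :
  belongs_to B V -> belongs_to B (submod_type hS).
Proof. by case=> e he eV; exists e => // v; apply: val_inj; apply: eV. Qed.

End Submodule.

(** A functor's [fmap] takes bundled linear maps, so pointwise equality has to become equality of
    bundles before the functor can be applied. *)
Lemma linear_ext (A : nzRingType) (U V : lmodType A) (f g : {linear U -> V}) :
  f =1 g -> f = g.
Proof.
case: f g => [f [[af] [sf]]] [g [[ag] [sg]]] /funext /= fg.
by subst g; rewrite (Prop_irrelevance af ag) (Prop_irrelevance sf sg).
Qed.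

(** * Morita equivalences: faithfulness and simplicity *)

Section MoritaTensor.
Variables (k : fieldType) (A B : algType k) (JA : {pred A}) (JB : {pred B}).
Variable M : bimodType A B.
Hypothesis moritaM : induces_morita JA JB M.

(** The unit [eta] is natural and injective, so a map is determined by its image under the
    functor. *)
Lemma morita_tensor_faithful (U V : bmodule JB) (f g : {linear U -> V}) :
  tensor_map (M := M) f =1 tensor_map g -> f =1 g.
Proof.
have [_ _ [hM [K [[eta [eta_bij eta_nat]] _]]]] := moritaM.
move=> /linear_ext Ffg u; apply: (bij_inj (eta_bij V)).
have := eta_nat U V f u; have := eta_nat U V g u => /=.
by rewrite Ffg => -> ->.
Qed.

Lemma tensor_map_surj (U V : lmodType B) (f : {linear U -> V}) :
  (forall v, exists u, f u = v) ->
  forall y, exists x, tensor_map (M := M) f x = y.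
Proof.
move=> f_surj; apply: tens_ind => [|x y [x' <-] [y' <-]|m v].
- by exists 0; rewrite raddf0.
- by exists (x' - y'); rewrite raddfB.
by have [u <-] := f_surj v; exists (tmul m u); rewrite [LHS]tens_mapE.
Qed.

Lemma tmul0r (V : lmodType B) (m : right_of M) : tmul m (0 : V) = 0.
Proof. by apply: (addrI (tmul m 0)); rewrite -tmulDr !addr0. Qed.

Lemma tmul0l (V : lmodType B) (v : V) : tmul (0 : right_of M) v = 0.
Proof. by apply: (addrI (tmul 0 v)); rewrite -tmulDl !addr0. Qed.

Lemma tensor_map_eq0 (U V : lmodType B) (f : {linear U -> V}) :
  (forall u, f u = 0) -> forall x, tensor_map (M := M) f x = 0.
Proof.
move=> f0; apply: (@tens_ext _ _ _ _ (tensor_map f) \0) => m u /=.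
by rewrite [LHS]tens_mapE f0 tmul0r.
Qed.

(** Submodules of M ⊗ V are compared with submodules of V through the quasi-inverse [K]. The
    nonvanishing of M ⊗ V is supplied later by the nonzero form. *)
Lemma morita_tensor_simple (V : bmodule JB) :
  simple_module V -> (exists x : tensor M V, x != 0) ->
  simple_module (tensor M V).
Proof.
have [_ _ [hM [K [[eta [eta_bij eta_nat]]
  [eps [eps_bij eps_nat]]]]]] := moritaM.
move=> [_ simV] W_neq0; split=> // S hS.
set F := tensor_functor JB hM in K eta eta_bij eta_nat eps eps_bij eps_nat *.
pose T := BModule (submod_belongs_to hS (bmodP (F V))).
pose i : {linear T -> F V} := @submod_incl _ _ _ hS.
have epsi t : i (eps T t) = eps (F V) (tensor_map (fmap K i) t).
  by rewrite -[LHS]/((i \o eps T) t) -eps_nat.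
(* By simplicity of V, fmap K i is zero or onto; F reflects both properties   *)
(* to i, since tensoring is right exact.                                      *)
pose im : {pred V} := fun v => `[< exists t, fmap K i t = eta V v >].
have [|im0|imT] := simV im.
- split=> [|a u v /asboolP [s su] /asboolP [t tv]]; apply/asboolP.
    by exists 0; rewrite !raddf0.
  by exists (a *: s + t); rewrite !linearP su tv.
- left=> v vS; suff i0 t : i t = 0 by have := i0 (exist _ v vS).
  have Ki0 s : fmap K i s = 0.
    have [g _ gK] := eta_bij V.
    have /im0 g0 : g (fmap K i s) \in im by apply/asboolP; exists s; rewrite gK.
    by rewrite -[LHS]gK g0 raddf0.
  have [g _ gK] := eps_bij T.
  by rewrite -[t]gK epsi tensor_map_eq0 // raddf0.
right=> v; have [g _ gK] := eps_bij (F V).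
have Ki_surj x : exists s, fmap K i s = x.
  have [h _ hK] := eta_bij V; have /asboolP [s] := imT (h x).
  by rewrite hK; exists s.
have [t tg] := tensor_map_surj Ki_surj (g v).
by rewrite -[v]gK -tg -epsi; apply: valP.
Qed.

(** Right multiplication by [a] is an endomorphism of the left module [JB]. The functor kills it, so
    it is zero, and its value at the identity [e] is [a]. *)
Lemma morita_right_faithful (a : B) :
  (exists2 e, identity_of JB e & e * a = a) -> two_sided_ideal JB ->
  (forall m : M, ract m a = 0) -> a = 0.
Proof.
move=> [e he ea] [zJB mJB] Ma0.
pose R : lmodType B := B^o.
have hJ : submod_closed (JB : {pred R}).
  case: (zJB) => J0 JB'; have JN x : x \in JB -> - x \in JB.
    by move=> ?; rewrite -sub0r JB'.
  split=> // c x y Jx Jy; rewrite -[y]opprK JB' ?JN //.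
  by have [] := mJB c x Jx.
pose T := submod_type hJ.
have hT : belongs_to JB T.
  exists e => // v; apply: val_inj.
  by have [_ /(_ (val v) (valP v)) []] := he.
have hf (x : T) : val x * a \in JB by have [] := mJB a (val x) (valP x).
pose f (x : T) : T := exist _ (val x * a) (hf x).
have f_lin : linear f.
  by move=> c x y; apply: val_inj; rewrite /= mulrDl -scalerAl.
pose F := HB.pack_for {linear T -> T} f (GRing.isLinear.Build _ _ _ _ f f_lin).
(* Tensoring kills right multiplication by a on JB, since M a = 0.            *)
have F0 : (F : T -> T) =1 \0.
  apply: (@morita_tensor_faithful (BModule hT) (BModule hT) F \0).
  move=> y; rewrite [RHS]tensor_map_eq0 //; move: y.
  apply: (@tens_ext _ _ _ _ (tensor_map F) \0) => m x.
  (* Writing x a as (x a) e lets x a cross the tensor sign, and m (x a) = (m x) a = 0. *)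
  have eJ := he.1; pose eT : T := exist _ e eJ.
  have xe y : val y *: eT = y :> T.
    by apply: val_inj; have [_ /(_ (val y) (valP y)) []] := he.
  rewrite [LHS]tens_mapE /= -[f x]xe -tmulA.
  rewrite -[LHS]/(tmul (ract m (val x * a) : right_of M) eT).
  by rewrite -ractA Ma0 tmul0l.
have [eJ _] := he.
by have /(congr1 val) /= := F0 (exist _ e eJ); rewrite ea.
Qed.

End MoritaTensor.

(** * Linear algebra on a spanning family *)

Lemma scalar_sumZ (k : pzRingType) (U : lmodType k) (f : U -> k) (I : finType)
    (c : I -> k) (x : I -> U) :
  scalar f -> f (\sum_i c i *: x i) = \sum_i c i * f (x i).
Proof.
move=> f_lin.
pose F := HB.pack_for {scalar U} f (GRing.isLinear.Build _ _ _ _ f f_lin).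
by rewrite -[f]/(F : U -> k) linear_sum; apply: eq_bigr => i _; rewrite linearZ.
Qed.

Lemma scalar_eq0 (k : pzRingType) (U : lmodType k) (f : U -> k) :
  scalar f -> f 0 = 0.
Proof. by move=> /(_ (-1) 0 0); rewrite scaler0 addr0 mulN1r addNr. Qed.

Section SpannedForms.
Variables (k : fieldType) (U : lmodType k) (n : nat) (s : 'I_n -> U).

Definition lincomb (u : 'rV[k]_n) : U := \sum_i u 0 i *: s i.

Fact lincomb_linear : linear lincomb.
Proof.
move=> c u v; rewrite /lincomb scaler_sumr -big_split; apply: eq_bigr => i _.
by rewrite !mxE scalerDl scalerA.
Qed.

HB.instance Definition _ :=
  GRing.isLinear.Build k 'rV[k]_n U *:%R lincomb lincomb_linear.

Lemma scalar_lincomb (f : U -> k) u :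
  scalar f -> f (lincomb u) = \sum_i u 0 i * f (s i).
Proof. exact: scalar_sumZ. Qed.

Hypothesis s_span : forall x, exists u, x = lincomb u.
Variable b : U -> U -> k.
Hypothesis bl : forall y, scalar (b^~ y).
Hypothesis br : forall x, scalar (b x).
Hypothesis b_nondeg : forall y, (forall x, b x y = 0) -> y = 0.

(** The family [s] need not be free. A column killed by the Gram matrix [B] is the coefficient
    vector of an element of the right radical, hence of 0, so every functional kills it; thus the
    rows of values [Fm] lie in the row space of [B]. *)
Lemma gram_represent m (f : 'I_m -> U -> k) :
  (forall i, scalar (f i)) ->
  exists X : 'M[k]_(m, n), forall i y, f i y = b (lincomb (row i X)) y.
Proof.
move=> f_lin; pose B := \matrix_(i, j) b (s i) (s j).
pose Fm := \matrix_(i, j) f i (s j).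
have FB : (Fm <= B)%MS.
  rewrite submxE; apply/eqP/matrixP => i j; rewrite !mxE.
  transitivity (f i (lincomb (col j (cokermx B))^T)).
    by rewrite scalar_lincomb //; apply: eq_bigr => l _; rewrite !mxE mulrC.
  rewrite (b_nondeg (y := lincomb _)) => [|x].
    exact: scalar_eq0.
  have [u ->] := s_span x; rewrite (scalar_lincomb _ (bl _)) big1 // => l _.
  rewrite (scalar_lincomb _ (br _)); apply/eqP; rewrite mulf_eq0.
  apply/orP; right.
  have /matrixP/(_ l j) := mulmx_coker B; rewrite !mxE => BC0.
  by rewrite -[X in _ == X]BC0; apply/eqP/eq_bigr => t _; rewrite !mxE mulrC.
exists (Fm *m pinvmx B) => i y; have [u ->] := s_span y.
rewrite (scalar_lincomb _ (br _)) (scalar_lincomb _ (f_lin _)).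
apply: eq_bigr => j _; congr (_ * _); rewrite (scalar_lincomb _ (bl _)).
have /matrixP/(_ i j) := mulmxKpV FB; rewrite !mxE => <-.
by apply: eq_bigr => l _; rewrite !mxE.
Qed.

End SpannedForms.

(** This finds an eigenvector modulo the kernel of [f], which [X] is not assumed to preserve: apply
    the factors one by one and stop just before [f] vanishes. *)
Lemma prod_eigenvector (k : fieldType) (U : zmodType) (n : nat)
    (f : {additive 'rV[k]_n.+1 -> U}) (X : 'M[k]_n.+1) (r : seq k) u :
  f u != 0 -> f (u *m \prod_(z <- r) (X - z%:M)) = 0 ->
  exists v z, f v != 0 /\ f (v *m X) = f (z *: v).
Proof.
elim: r u => [|z r IHr] u fu0.
  by rewrite big_nil mulmx1 => /eqP /(negP fu0).
rewrite big_cons mulmxA; have [fXz0 _|] := eqVneq (f (u *m (X - z%:M))) 0.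
  exists u, z; split=> //; apply/eqP.
  by rewrite -subr_eq0 -raddfB -mul_mx_scalar -mulmxBr fXz0.
exact: IHr.
Qed.

(** Cayley-Hamilton, with the characteristic polynomial split into linear factors. *)
Lemma closed_eigenvector (k : closedFieldType) (U : zmodType) (n : nat)
    (f : {additive 'rV[k]_n.+1 -> U}) (X : 'M[k]_n.+1) u :
  f u != 0 -> exists v z, f v != 0 /\ f (v *m X) = f (z *: v).
Proof.
move=> fu0; have [r] := closed_field_poly_normal (char_poly X).
rewrite (monicP (char_poly_monic X)) scale1r => charX.
apply: (prod_eigenvector (r := r) fu0).
rewrite -[\prod_(_ <- _) _](_ : horner_mx X (char_poly X) = _).
  by rewrite Cayley_Hamilton mulmx0 raddf0.
rewrite charX rmorph_prod; apply: eq_bigr => z _.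
by rewrite rmorphB /= horner_mx_X horner_mx_C.
Qed.

(** * The antipode and invariant forms *)

Section Antipode.
Variables (k : fieldType) (G : finGroupType).
Implicit Types a : galg k G.

Definition antipode a : galg k G := [ffun g => a g^-1%g].

Lemma antipodeK : involutive antipode.
Proof. by move=> a; apply/ffunP=> g; rewrite !ffunE invgK. Qed.

Lemma antipode_sum a : antipode a = \sum_g (a g : k) *: gbase g^-1%g.
Proof.
rewrite [LHS]galg_sum_base (reindex_inj invg_inj) /=.
by apply: eq_bigr => g _; rewrite ffunE invgK.
Qed.

Lemma antipode_scalar c : antipode c%:A = c%:A.
Proof.
rewrite -gbase1; apply/ffunP=> g; rewrite !ffunE.
by rewrite -(inj_eq invg_inj) invgK invg1.
Qed.

End Antipode.

Section KSpace.
Variables (k : fieldType) (A : algType k) (V : lmodType A).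

Lemma kspace_scalerA (c : k) (a : A) (x : V) :
  (c *: a) *: x = c *: (a *: x : kspace V).
Proof. by rewrite -[RHS]/(c%:A *: (a *: x)) scalerA -scalerAl mul1r. Qed.

End KSpace.

Lemma galg_scale_sum (k : fieldType) (G : finGroupType)
    (V : lmodType (galg k G)) (a : galg k G) (x : V) :
  a *: x = \sum_g (a g : k) *: (gbase g *: x : kspace V) :> kspace V.
Proof.
rewrite {1}[a]galg_sum_base scaler_suml.
by apply: eq_bigr => g _; rewrite kspace_scalerA.
Qed.

Section InvariantForms.
Variables (k : fieldType) (G : finGroupType) (V : lmodType (galg k G)).
Local Notation kG := (galg k G).
Implicit Types (b : V -> V -> k) (x y : V).

(** Forms are unbundled functions so that they can be transposed and subtracted freely. Invariance
    is stated as adjointness for all of kG; [invariant_form_gbase] and [invariant_formG] relate it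
    to invariance under G. *)
Record invariant_form b : Prop := InvariantForm {
  invariant_forml : forall y, scalar (b^~ y : kspace V -> k);
  invariant_formr : forall x, scalar (b x : kspace V -> k);
  invariant_formA : forall (a : kG) x y, b (a *: x) y = b x (antipode a *: y)
}.

Definition form_sign (e : form_type) : k :=
  if e is Symmetric then 1 else -1.

Lemma invariant_form_gbase b :
  (forall y, scalar (b^~ y : kspace V -> k)) ->
  (forall x, scalar (b x : kspace V -> k)) ->
  (forall g x y, b (gbase g *: x) (gbase g *: y) = b x y) -> invariant_form b.
Proof.
move=> bl br bG; split=> // a x y.
rewrite antipode_sum scaler_suml.
rewrite {1}[a]galg_sum_base scaler_suml.
under eq_bigr => g _ do rewrite kspace_scalerA.
under [in RHS]eq_bigr => g _ do rewrite kspace_scalerA.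
rewrite (scalar_sumZ (U := kspace V) _ _ (bl y)).
rewrite (scalar_sumZ (U := kspace V) _ _ (br x)).
apply: eq_bigr => g _; congr (_ * _).
by rewrite -(bG g x) scalerA -gbaseM mulgV scale1r.
Qed.

Lemma invariant_formG b g x y :
  invariant_form b -> b (gbase g *: x) (gbase g *: y) = b x y.
Proof.
move=> hb; rewrite (invariant_formA hb) scalerA.
suff -> : antipode (gbase g) * gbase g = 1 :> kG by rewrite scale1r.
rewrite -gbase1 -(mulVg g) gbaseM; congr (_ * _).
by apply/ffunP=> h; rewrite !ffunE -(inj_eq invg_inj) invgK.
Qed.

Lemma invariant_formC b : invariant_form b -> invariant_form (fun x y => b y x).
Proof.
case=> bl br bA; split=> // a x y.
by rewrite bA antipodeK.
Qed.

Lemma invariant_formB b b' c : invariant_form b -> invariant_form b' ->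
  invariant_form (fun x y => b x y - c * b' x y).
Proof.
case=> bl br bA [bl' br' bA']; split=> [y d x x'|x d y y'|a x y].
- by rewrite bl bl' mulrBr mulrDr opprD addrACA mulrCA.
- by rewrite br br' mulrBr mulrDr opprD addrACA mulrCA.
by rewrite bA bA'.
Qed.

Lemma has_typeP e :
  has_type V e <-> exists b,
    [/\ invariant_form b, forall x, (forall y, b x y = 0) -> x = 0,
        forall y, (forall x, b x y = 0) -> y = 0
      & forall x y, b x y = form_sign e * b y x].
Proof.
split=> [[b [[bl br] bG bt]]|[b [hb bl br bt]]].
  exists b; split=> //.
    apply: invariant_form_gbase => // [y c x x'|x c y y'].
      by rewrite linearPl.
    by rewrite linearPr.
  by case: e bt => bt x y; rewrite bt /= ?mul1r ?mulN1r.
have [hl hr _] := hb.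
pose b' : kspace V -> kspace V -> k := b.
pose B := HB.pack_for {biscalar kspace V} b'
  (bilinear_isBilinear.Build k (kspace V) (kspace V) k *%R *%R b' (hl, hr)).
exists B; split=> // [g x y|]; first exact: invariant_formG.
by case: e bt => bt x y; rewrite [LHS]bt /= ?mul1r ?mulN1r.
Qed.

Lemma dual_fun_scalar (f : dual V) : scalar (dual_fun f : kspace V -> k).
Proof. by move=> c x y; rewrite [LHS](linearP (f : {scalar kspace V})). Qed.

Lemma dual_fun_antipode (a : kG) (f : dual V) x :
  dual_fun (a *: f) x = dual_fun f (antipode a *: x).
Proof.
rewrite antipode_sum scaler_suml.
under [in RHS]eq_bigr => g _ do rewrite kspace_scalerA.
by rewrite (scalar_sumZ (U := kspace V) _ _ (dual_fun_scalar f)).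
Qed.

(** The dictionary is phi(x)(y) = b x y: left nondegeneracy is injectivity of phi, and
    representability of all functionals is surjectivity. *)
Lemma self_dualP :
  self_dual V <-> exists b,
    [/\ invariant_form b, forall x, (forall y, b x y = 0) -> x = 0
      & forall f : kspace V -> k, scalar f -> exists x, f =1 b x].
Proof.
split=> [[phi phi_bij]|[b [hb bl b_onto]]].
  exists (fun x => dual_fun (phi x)); split.
  - apply: invariant_form_gbase => [y c x x'|x c y y'|g x y].
    + rewrite linearP dual_funD dual_fun_antipode antipode_scalar.
      congr (_ + _).
      have := dual_fun_scalar (phi x) c y 0.
      by rewrite !addr0 (scalar_eq0 (dual_fun_scalar _)) addr0.
    + exact: dual_fun_scalar.
    by rewrite linearZ dual_scaleE scalerA -gbaseM mulVg scale1r.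
  - move=> x phix0; apply: (bij_inj phi_bij); rewrite raddf0.
    exact: dual_ext.
  move=> f f_lin; have [g _ phiK] := phi_bij.
  pose F := HB.pack_for {scalar kspace V} f
    (GRing.isLinear.Build _ _ _ _ f f_lin).
  by exists (g F); rewrite phiK.
have hbr := invariant_formr hb.
pose psi x : dual V := HB.pack_for {scalar kspace V} (b x : kspace V -> k)
  (GRing.isLinear.Build _ _ _ _ _ (hbr x)).
have psi_lin : linear psi.
  move=> a x y; apply: dual_ext => t.
  rewrite dual_funD dual_fun_antipode /dual_fun /=.
  rewrite -(invariant_formA hb).
  have := invariant_forml hb t 1 (a *: x) y.
  by rewrite scale1r mul1r.
pose Psi := HB.pack_for {linear V -> dual V} psi
  (GRing.isLinear.Build _ _ _ _ _ psi_lin).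
have psi_inj : injective psi.
  move=> x y psi_xy; apply/eqP; rewrite -subr_eq0; apply/eqP/bl => t.
  have /= := linearB Psi x y; rewrite psi_xy subrr => h.
  by rewrite -[b _ _]/(dual_fun (psi (x - y)) t) h.
have psi_onto f : exists x, psi x = f.
  have [x fx] := b_onto _ (dual_fun_scalar f).
  by exists x; apply: dual_ext => t; rewrite fx.
have [g gK] := choice psi_onto.
by exists Psi; exists g => // x; apply: psi_inj; rewrite gK.
Qed.

End InvariantForms.

(** * Invariant forms on a simple module *)

Section SimpleForms.
Variables (k : fieldType) (G : finGroupType) (V : lmodType (galg k G)).
Hypothesis simpleV : simple_module V.

Lemma simple_span :
  exists n (s : 'I_n.+1 -> kspace V), forall x, exists u, x = lincomb s u.
Proof.
have [[v v0] simV] := simpleV.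
(* The orbit of a nonzero vector spans. Its length is written as a successor because
   [closed_eigenvector] works in a ring of square matrices. *)
have nG : #|G|.-1.+1 = #|G| by rewrite prednK //; apply/card_gt0P; exists 1%g.
exists #|G|.-1, (fun i => gbase (enum_val (cast_ord nG i)) *: v) => x.
have [|S0|/(_ x) /asboolP [a ->]] :=
    simV (fun y => `[< exists a, y = a *: v >]).
- split=> [|c y z /asboolP [a ->] /asboolP [b ->]]; apply/asboolP.
    by exists 0; rewrite scale0r.
  by exists (c * a + b); rewrite scalerDl scalerA.
- by case/eqP: v0; apply: S0; apply/asboolP; exists 1; rewrite scale1r.
exists (\row_i (a (enum_val (cast_ord nG i)) : k)).
rewrite galg_scale_sum /lincomb.
rewrite (reindex (fun i => enum_val (cast_ord nG i))) /=.
  by apply: eq_bigr => i _; rewrite mxE.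
exists (fun g => cast_ord (esym nG) (enum_rank g)) => g _.
  by rewrite enum_valK cast_ordK.
by rewrite cast_ordKV enum_rankK.
Qed.

(** By adjointness the left radical is a submodule, and it is proper as the form is nonzero. *)
Lemma simple_form_nondegl (b : V -> V -> k) : invariant_form b ->
  (exists x y, b x y != 0) -> forall x, (forall y, b x y = 0) -> x = 0.
Proof.
move=> hb [x0 [y0 bxy0]] x bx0.
have [|S0|/(_ x0) /asboolP /(_ y0) b0] :=
    simpleV.2 (fun z => `[< forall y, b z y = 0 >]).
- split=> [|a z z' /asboolP bz /asboolP bz']; apply/asboolP => y.
    exact: scalar_eq0 (invariant_forml hb y).
  have := invariant_forml hb y 1 (a *: z) z'; rewrite scale1r => ->.
  by rewrite (invariant_formA hb) bz bz' mulr0 addr0.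
- by apply: S0; apply/asboolP.
by rewrite b0 eqxx in bxy0.
Qed.

Lemma nondegl_form_neq0 (b : V -> V -> k) :
  (forall x, (forall y, b x y = 0) -> x = 0) -> exists x y, b x y != 0.
Proof.
move=> bl; apply: contrapT => b0; have [[v /eqP v0] _] := simpleV.
apply: v0; apply: bl => y; apply/eqP/negPn/negP => bvy.
by apply: b0; exists v, y.
Qed.

Lemma simple_form_nondegr (b : V -> V -> k) : invariant_form b ->
  (exists x y, b x y != 0) -> forall y, (forall x, b x y = 0) -> y = 0.
Proof.
move=> /invariant_formC hb [x [y bxy]].
by apply: simple_form_nondegl hb _; exists y, x.
Qed.

Lemma simple_form_self_dual (b : V -> V -> k) : invariant_form b ->
  (exists x y, b x y != 0) -> self_dual V.
Proof.
move=> hb b0; apply/self_dualP; exists b; split=> //.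
  exact: simple_form_nondegl.
move=> f f_lin; have [n [s s_span]] := simple_span.
have [//|X fX] := gram_represent s_span (invariant_forml hb)
  (invariant_formr hb) (simple_form_nondegr hb b0) (f := fun _ : 'I_1 => f).
by exists (lincomb s (row 0 X)) => y; rewrite (fX 0).
Qed.

End SimpleForms.

(** * Existence and uniqueness of the type *)

Section ClosedField.
Variables (k : closedFieldType) (G : finGroupType) (V : lmodType (galg k G)).
Hypothesis simpleV : simple_module V.

(** Schur's lemma in matrix form: [X] represents [b'] through [b] on coefficient rows, and an
    eigenvector of [X] modulo the relations among the [s i] gives the factor [c]. *)
Lemma simple_forms_proportional (b b' : V -> V -> k) :
  invariant_form b -> invariant_form b' ->
  (exists x y, b x y != 0) -> exists c, forall x y, b' x y = c * b x y.
Proof.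
move=> hb hb' b0; have [n [s s_span]] := simple_span simpleV.
have [X b'X] := gram_represent s_span (invariant_forml hb) (invariant_formr hb)
  (simple_form_nondegr simpleV hb b0) (f := fun i => b' (s i))
  (fun i => invariant_formr hb' (s i)).
have {}b'X u y : b' (lincomb s u) y = b (lincomb s (u *m X)) y.
  rewrite (scalar_lincomb _ _ (invariant_forml hb' y)) mulmx_sum_row linear_sum.
  under [in RHS]eq_bigr => i _ do rewrite linearZ /=.
  rewrite (scalar_sumZ (U := kspace V) _ _ (invariant_forml hb y)).
  by apply: eq_bigr => i _; rewrite b'X.
have [[v v0] _] := simpleV; have [u vu] := s_span v.
have [|w [c [w0 wX]]] := closed_eigenvector (f := lincomb s) X (u := u).
  by rewrite vu in v0.
(* b' - c b has the nonzero vector lincomb s w in its radical.                *)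
exists c; have hd := invariant_formB c hb' hb.
suff d0 x y : b' x y - c * b x y = 0.
  by move=> x y; apply/eqP; rewrite -subr_eq0 d0.
apply/eqP/negPn/negP => dxy; case/eqP: w0.
apply: (simple_form_nondegl simpleV hd); first by exists x, y.
move=> {x y dxy}y; rewrite b'X wX /= linearZ /=.
have := invariant_forml hb y c (lincomb s w) 0.
by rewrite addr0 (scalar_eq0 (invariant_forml hb y)) addr0 => ->; rewrite subrr.
Qed.

(** The transpose of b is c b; transposing twice gives c^2 = 1, so c is 1 or -1. *)
Lemma self_dual_has_type : self_dual V -> exists e, has_type V e.
Proof.
case/self_dualP => b [hb bl _].
have b0 := nondegl_form_neq0 simpleV bl.
have [c bc] := simple_forms_proportional hb (invariant_formC hb) b0.
have c1 : c ^+ 2 = 1.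
  have [x [y bxy]] := b0; apply: (mulIf bxy).
  by rewrite mul1r expr2 -mulrA -bc -bc.
have /orP [/eqP c_1|/eqP c_1] : (c == 1) || (c == -1).
  by rewrite -eqf_sqr c1 expr1n.
  exists Symmetric; apply/has_typeP; exists b; split=> //.
    exact: simple_form_nondegr hb b0.
  by move=> x y; rewrite bc c_1 /= !mul1r.
exists Antisymmetric; apply/has_typeP; exists b; split=> //.
  exact: simple_form_nondegr hb b0.
by move=> x y; rewrite bc c_1.
Qed.

Lemma has_type_uniq e e' : 2%:R != 0 :> k ->
  has_type V e -> has_type V e' -> e = e'.
Proof.
move=> two0 /has_typeP [b [hb bl br bt]] /has_typeP [b' [hb' bl' br' bt']].
have [c b'c] := simple_forms_proportional hb hb' (nondegl_form_neq0 simpleV bl).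
have [x [y]] := nondegl_form_neq0 simpleV bl'.
(* Both sides equal [b' x y]: the left by the symmetry of [b], the right by that of [b']. *)
have : c * (form_sign k e * b y x) = form_sign k e' * (c * b y x).
  by rewrite -bt -!b'c -bt'.
rewrite bt' b'c mulrCA => eq_sign; rewrite mulf_eq0 negb_or => /andP[_] /mulIf.
move=> /(_ _ _ eq_sign); case: e e' {bt bt' eq_sign} => [] [] //= /eqP.
  by rewrite -subr_eq0 opprK (negPf two0).
by rewrite eq_sym -subr_eq0 opprK (negPf two0).
Qed.

End ClosedField.

(** * The form on the tensor product *)

Section TensorForm.
Variables (k : fieldType) (G H : finGroupType).
Variables (M : bimodType (galg k H) (galg k G)) (bM : {biscalar M}).
Hypothesis bM_inv : forall (h : H) (g : G) (m n : M),
  bM (ract (lact (gbase h) m) (gbase g))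
     (ract (lact (gbase h) n) (gbase g)) = bM m n.

Fact bM_scalarl n : scalar (bM^~ n).
Proof. by move=> c m m'; rewrite linearPl. Qed.

Fact bM_scalarr m : scalar (bM m).
Proof. by move=> c n n'; rewrite linearPr. Qed.

Lemma lact_sum (a : galg k H) (m : M) :
  lact a m = \sum_h (a h : k) *: lact (gbase h) m.
Proof.
rewrite {1}[a]galg_sum_base.
rewrite (big_morph (fun a => lact a m) (id1 := 0) (op1 := +%R)).
- by apply: eq_bigr => h _; rewrite lactZl.
- exact: lactDl.
by apply: (addrI (lact 0 m)); rewrite -lactDl !addr0.
Qed.

Lemma ract_sum (a : galg k G) (m : M) :
  ract m a = \sum_g (a g : k) *: ract m (gbase g).
Proof.
rewrite {1}[a]galg_sum_base.
rewrite (big_morph (ract m) (id1 := 0) (op1 := +%R)).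
- by apply: eq_bigr => h _; rewrite ractZr.
- exact: ractDr.
by apply: (addrI (ract m 0)); rewrite -ractDr !addr0.
Qed.

Lemma bM_lactA a m n : bM (lact a m) n = bM m (lact (antipode a) n).
Proof.
rewrite !lact_sum (reindex_inj invg_inj) /= (scalar_sumZ _ _ (bM_scalarl n)).
rewrite (scalar_sumZ _ _ (bM_scalarr m)); apply: eq_bigr => h _; rewrite ffunE.
congr (_ * _); rewrite -(bM_inv h 1 _ n) gbase1 !ract1 lactA -gbaseM.
by rewrite mulgV gbase1 lact1.
Qed.

Lemma bM_ractA a m n : bM (ract m a) n = bM m (ract n (antipode a)).
Proof.
rewrite !ract_sum (reindex_inj invg_inj) /= (scalar_sumZ _ _ (bM_scalarl n)).
rewrite (scalar_sumZ _ _ (bM_scalarr m)); apply: eq_bigr => g _; rewrite ffunE.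
congr (_ * _); rewrite -(bM_inv 1 g _ n) gbase1 !lact1 ractA -gbaseM.
by rewrite mulVg gbase1 ract1.
Qed.

Variables (V : lmodType (galg k G)) (b : V -> V -> k).
Hypothesis b_inv : invariant_form b.

(** The inverse on g makes [matrix_coef^~ w] a homomorphism of left kG-modules from V to kG. *)
Definition matrix_coef (v w : V) : galg k G :=
  [ffun g => b (gbase g^-1%g *: v) w].

Lemma matrix_coefDl w : {morph matrix_coef^~ w : v v' / v + v'}.
Proof.
move=> v v'; apply/ffunP=> g; rewrite !ffunE scalerDr.
have := invariant_forml b_inv w 1 (gbase g^-1%g *: v) (gbase g^-1%g *: v').
by rewrite scale1r mul1r.
Qed.

Lemma matrix_coefDr v : {morph matrix_coef v : w w' / w + w'}.
Proof.
move=> w w'; apply/ffunP=> g; rewrite !ffunE.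
have := invariant_formr b_inv (gbase g^-1%g *: v) 1 w w'.
by rewrite scale1r mul1r.
Qed.

Lemma matrix_coefAl a v w : matrix_coef (a *: v) w = a * matrix_coef v w.
Proof.
apply/ffunP=> g; rewrite !ffunE scalerA {1}[a]galg_sum_base mulr_sumr.
rewrite scaler_suml; under eq_bigr => h _ do
  rewrite -scalerAr -gbaseM kspace_scalerA.
rewrite (scalar_sumZ (U := kspace V) _ _ (invariant_forml b_inv w)).
by apply: eq_bigr => h _; rewrite ffunE invMg invgK.
Qed.

Lemma matrix_coefAr a v w :
  matrix_coef v (a *: w) = matrix_coef v w * antipode a.
Proof.
apply/ffunP=> g; rewrite !ffunE -{1}[a]antipodeK -(invariant_formA b_inv).
rewrite scalerA {1}antipode_sum mulr_suml.
rewrite scaler_suml; under eq_bigr => h _ do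
  rewrite -scalerAl -gbaseM kspace_scalerA.
rewrite (scalar_sumZ (U := kspace V) _ _ (invariant_forml b_inv w)).
rewrite [RHS](reindex_inj (mulgI g)) /=; apply: eq_bigr => h _.
by rewrite !ffunE mulrC !invMg !invgK mulKg.
Qed.

(** The coefficient at g becomes b(g v, w) = b(v, g^-1 w); swapping the arguments of b contributes
    the sign. *)
Lemma matrix_coef_antipode e v w :
  (forall x y, b x y = form_sign k e * b y x) ->
  antipode (matrix_coef v w) = form_sign k e *: matrix_coef w v.
Proof.
move=> bt; apply/ffunP=> g; rewrite !ffunE invgK bt; congr (_ * _).
by rewrite -(invariant_formG g^-1%g _ _ b_inv) scalerA -gbaseM mulVg scale1r.
Qed.

Lemma dual_funB (f : dual (tensor M V)) : {morph dual_fun f : x y / x - y}.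
Proof. by move=> x y; rewrite [LHS](linearB (f : {scalar kspace _})). Qed.

Lemma dual_tensor_ext (f f' : dual (tensor M V)) :
  (forall (m : right_of M) v,
    dual_fun f (tmul m v) = dual_fun f' (tmul m v)) -> f = f'.
Proof.
move=> ff'; apply: dual_ext; apply: tens_ind => [|x y fx fy|//].
  by rewrite -(subrr 0) !dual_funB !subrr.
by rewrite !dual_funB fx fy.
Qed.

Lemma tensor_form_exists : exists bW : tensor M V -> tensor M V -> k,
  invariant_form bW /\
  forall (m n : right_of M) v w,
    bW (tmul n w) (tmul m v) = bM (ract m (matrix_coef v w)) n.
Proof.
have balL (n : right_of M) w : balanced (M := right_of M)
    (fun m v => bM (ract m (matrix_coef v w)) n).
  split=> [v m m'|m v v'|m a v].
  - by rewrite ractDl linearDl.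
  - by rewrite matrix_coefDl ractDr linearDl.
  by rewrite matrix_coefAl -ractA.
pose L (n : right_of M) w : kspace (tensor M V) -> k :=
  tens_lift (fun (m : right_of M) v => bM (ract m (matrix_coef v w)) n).
have LE n w m v : L n w (tmul m v) = bM (ract m (matrix_coef v w)) n.
  exact: tens_liftE (balL n w) m v.
have LB n w : {morph L n w : x y / x - y} by exact: tens_liftB.
have L0 n w : L n w 0 = 0 by rewrite -(subrr 0) LB subrr.
have L_scalar n w : scalar (L n w).
  (* The lift is only additive; k acts on M ⊗ V through the factor M, so homogeneity is checked on
     pure tensors. *)
  suff LZ c x : L n w (c *: x) = c * L n w x.
    move=> c x y; rewrite -[y in LHS]opprK LB -[- y]sub0r LB L0 LZ.
    by rewrite sub0r opprK.
  move: x; apply: tens_ind => [|x y fx fy|m v].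
  - by rewrite scaler0 L0 mulr0.
  - by rewrite scalerBr !LB fx fy mulrBr.
  rewrite -[c *: _]/(c%:A *: (tmul m v : tensor M V)) tensor_scaleE !LE.
  by rewrite lactZl lact1 ractZl linearZl_LR.
pose dL (n : right_of M) w : dual (tensor M V) :=
  HB.pack_for {scalar kspace (tensor M V)} (L n w)
    (GRing.isLinear.Build k (kspace (tensor M V)) k *%R (L n w)
       (L_scalar n w)).
have dLE n w m v :
    dual_fun (dL n w) (tmul m v) = bM (ract m (matrix_coef v w)) n.
  exact: LE.
(* For the ring relation, moving [a] from n across [bM] produces S(a) to the right of c(v, w), which
   is c(v, a w). *)
have baldL : balanced (M := right_of M) dL.
  split=> [w n n'|n w w'|n a w]; apply: dual_tensor_ext => m v.
  - by rewrite dual_funD !dLE linearDr.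
  - by rewrite dual_funD !dLE matrix_coefDr ractDr linearDl.
  by rewrite !dLE matrix_coefAr -ractA [RHS]bM_ractA antipodeK.
pose Psi := tens_lift dL.
have PsiE n w : Psi (tmul n w) = dL n w by exact: tens_liftE.
have PsiB : {morph Psi : x y / x - y} by exact: tens_liftB.
exists (fun x y => dual_fun (Psi x) y); split; last first.
  by move=> *; rewrite PsiE dLE.
have Psi0 : Psi 0 = 0 by rewrite -[X in Psi X](subrr 0) PsiB subrr.
have PsiD : {morph Psi : x y / x + y}.
  move=> x y; rewrite -[y in LHS]opprK PsiB -[- y]sub0r PsiB Psi0 sub0r.
  by rewrite opprK.
have PsiA (a : galg k H) (x : tensor M V) : Psi (a *: x) = a *: Psi x.
  move: x; apply: tens_ind => [|x y fx fy|n w].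
  - by rewrite scaler0 Psi0 scaler0.
  - by rewrite scalerBr !PsiB fx fy scalerBr.
  apply: dual_tensor_ext => m v; rewrite tensor_scaleE PsiE dual_fun_antipode.
  by rewrite tensor_scaleE PsiE !dLE lractA bM_lactA antipodeK.
split=> [y c x x'|x c y y'|a x y].
- rewrite -[c *: x]/(c%:A *: (x : tensor M V)) PsiD PsiA dual_funD.
  rewrite dual_fun_antipode antipode_scalar; congr (_ + _).
  have := dual_fun_scalar (Psi x) c y 0.
  by rewrite !addr0 (scalar_eq0 (dual_fun_scalar _)) addr0.
- exact: dual_fun_scalar.
by rewrite PsiA dual_fun_antipode.
Qed.

End TensorForm.

(** * Transport of the type *)

Lemma tensor_form (k : fieldType) (G H : finGroupType)
    (BG : {pred galg k G}) (BH : {pred galg k H})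
    (M : bimodType (galg k H) (galg k G)) (V : lmodType (galg k G))
    (e : form_type) :
  two_sided_ideal BG -> induces_morita BH BG M -> symmetric_bimodule M ->
  belongs_to BG V -> simple_module V -> has_type V e ->
  exists bW : tensor M V -> tensor M V -> k,
    [/\ invariant_form bW, exists x y, bW x y != 0
      & forall x y, bW x y = form_sign k e * bW y x].
Proof.
move=> idealBG moritaM [bM [[bMl _] bM_inv bM_sym]] [e1 he1 e1V] simpleV.
move=> /has_typeP [b [hb bl _ bt]].
have [bW [hbW bWE]] := tensor_form_exists bM_inv hb.
exists bW; split=> //.
  (* If the form vanished, nondegeneracy of [bM] would give M c(v, w) = 0, hence c(v, w) = 0; but
     its coefficient at 1 is b(v, w). *)
  have [v [w bvw]] := nondegl_form_neq0 simpleV bl; apply: contrapT => bW0.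
  suff coef0 : matrix_coef b v w = 0.
    move/eqP: bvw; apply; have /ffunP/(_ 1%g) := coef0.
    by rewrite !ffunE invg1 gbase1 scale1r.
  apply: (morita_right_faithful moritaM _ idealBG) => [|m].
    by exists e1; rewrite // -(matrix_coefAl hb) e1V.
  apply: bMl => n; apply/eqP/negPn/negP => bMmn; apply: bW0.
  by exists (tmul (n : right_of M) w), (tmul (m : right_of M) v); rewrite bWE.
have bWBl y : {morph bW^~ y : x x' / x - x'}.
  move=> x x'; have := invariant_forml hbW y (-1) x' x.
  by rewrite scaleN1r mulN1r ![- _ + _]addrC.
have bWBr x : {morph bW x : y y' / y - y'}.
  move=> y y'; have := invariant_formr hbW x (-1) y' y.
  by rewrite scaleN1r mulN1r ![- _ + _]addrC.
have bW0l := scalar_eq0 (invariant_forml hbW _).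
have bW0r := scalar_eq0 (invariant_formr hbW _).
apply: tens_ind => [y|x x' IHx IHx' y|n w].
- by rewrite bW0l bW0r mulr0.
- by rewrite bWBl bWBr IHx IHx' mulrBr.
apply: tens_ind => [|y y' IHy IHy'|m v].
- by rewrite bW0l bW0r mulr0.
- by rewrite bWBl bWBr IHy IHy' mulrBr.
(* Here (m c(v, w), n) = (m, n S(c(v, w))) = ± (m, n c(w, v)), and the symmetry of [bM] finishes
   without a further sign. *)
rewrite !bWE (bM_ractA bM_inv) (matrix_coef_antipode hb _ _ bt).
by rewrite ractZr linearZr_LR bM_sym.
Qed.

Theorem theoremB (k : closedFieldType) (p : nat)
    (charkp : p \in [pchar k]) (odd_p : odd p) (G H : finGroupType)
    (BG : {pred galg k G}) (BH : {pred galg k H})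
    (blockBG : is_block BG) (blockBH : is_block BH)
    (M : bimodType (galg k H) (galg k G))
    (moritaM : induces_morita BH BG M) (symM : symmetric_bimodule M)
    (V : lmodType (galg k G)) (BGV : belongs_to BG V)
    (simpleV : simple_module V) (self_dualV : self_dual V) :
  [/\ belongs_to BH (tensor M V),
      simple_module (tensor M V),
      self_dual (tensor M V)
    & forall e : form_type, has_type (tensor M V) e <-> has_type V e].
Proof.
have idealBG := blockBG.1.1.
have two0 : 2%:R != 0 :> k.
  rewrite -(dvdn_pcharf charkp) dvdn_prime2 ?(pcharf_prime charkp) //.
  by apply: contraTneq odd_p => ->.
have [e0 Ve0] := self_dual_has_type simpleV self_dualV.
have form e := tensor_form (e := e) idealBG moritaM symM BGV simpleV.
have [bW [hbW bW0 _]] := form e0 Ve0.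
have simpleW : simple_module (tensor M V).
  apply: (morita_tensor_simple moritaM (V := BModule BGV)) => //.
  have [x [y bxy]] := bW0; exists x; apply: contra_neq bxy => ->.
  exact: scalar_eq0 (invariant_forml hbW y).
have VW e : has_type V e -> has_type (tensor M V) e.
  move=> /form [b [hb b0 bt]]; apply/has_typeP; exists b; split=> //.
    exact: simple_form_nondegl.
  exact: simple_form_nondegr.
split=> //.
- by have [_ _ [hM _]] := moritaM; apply: tensor_belongs_to.
- exact: simple_form_self_dual bW0.
move=> e; split=> [We|]; last exact: VW.
by rewrite (has_type_uniq simpleW two0 We (VW _ Ve0)).
Qed.
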